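(* Let $f$ be a measurable function on $\mathbb{R}$, and suppose that the following two conditions hold: (i) the function $\Delta(x) = f\left(x + \frac{\pi}{2}\right) - f(x)$ belongs to $L^2(\mathbb{R})$; (ii) the function $x \mapsto f(x)\sin(x)$ belongs to $L^2(\mathbb{R})$. Then $f \in L^2(\mathbb{R})$.
   Context: Measurability and $L^2(\mathbb{R})$ are with respect to Lebesgue measure on $\mathbb{R} = (-\infty,\infty)$. *)

(* Defs.v *)
From mathcomp Require Import all_boot all_order all_algebra.
From mathcomp Require Import all_classical all_reals all_analysis.
From mathcomp Require Import complex.

Set Implicit Arguments.
Unset Strict Implicit.
Unset Printing Implicit Defensive.

Import Order.TTheory GRing.Theory Num.Theory.
Import numFieldNormedType.Exports.

Local Open Scope classical_set_scope.
Local Open Scope ring_scope.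
Local Open Scope complex_scope.

(* The canonical sigma-algebra on [R] contains only the Borel sets; this one is
   that of all Lebesgue measurable sets, the domain of
   [completed_lebesgue_measure]. *)
Notation leb_line R := (caratheodory_type (@wlength R idfun)^*%mu).

(* Lebesgue measurability of a complex-valued function on the line; the
   codomain of the two components carries the Borel sigma-algebra. *)
Definition lebesgue_measurable_fun (R : realType) (f : R -> R[i]) : Prop :=
  measurable_fun [set: leb_line R] (fun x : leb_line R => complex.Re (f x)) /\
  measurable_fun [set: leb_line R] (fun x : leb_line R => complex.Im (f x)).

(* Complex-valued functions, not taken up to equality almost everywhere;
   [finite_norm] is stated for real-valued functions, hence the modulus. *)
Definition L2 (R : realType) : set (R -> R[i]) :=
  [set f | lebesgue_measurable_fun f /\
     finite_norm (@completed_lebesgue_measure R) 2%:E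
       (fun x => Normc.normc (f x))].

(* Main.v *)
Require Import Defs.
From mathcomp Require Import all_boot all_order all_algebra.
From mathcomp Require Import all_classical all_reals all_analysis.
From mathcomp Require Import complex.
From mathcomp Require Import measurable_realfun ring lra.

Import Order.TTheory GRing.Theory Num.Theory.
Import numFieldNormedType.Exports.

Local Open Scope classical_set_scope.
Local Open Scope ring_scope.
Local Open Scope complex_scope.

(** Since cos^2 + sin^2 = 1, it is enough to show that f sin and f cos are both
    square integrable. The first one is so by assumption. Translating it by
    pi/2 turns the sine into a cosine: x |-> f (x + pi/2) cos x is in L^2, as
    Lebesgue measure is translation invariant. This function differs from
    f cos by Delta cos, which is dominated by Delta, so f cos is in L^2 too.
    The comparison is carried out pointwise on the squared moduli
    ([normc_rotation_bound]), so that only integrals of nonnegative functions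
    occur ([L2P]).

    Translation invariance for the completed measure ([L2_shift]) is obtained
    at the level of the outer measure: translating a cover by half-open
    intervals gives a cover of the same total length, whence the invariance of
    the outer measure, of its Caratheodory measurable sets, and of the
    integral of nonnegative functions. *)

Notation leb_mu R := (@completed_lebesgue_measure R).
Notation leb_outer R := ((@wlength R idfun)^*%mu).

Lemma wlength_preimage_shift (R : realType) (a : R) (A : set (ocitv_type R)) :
  measurable A ->
  measurable (shift a @^-1` A : set (ocitv_type R)) /\
  wlength idfun (shift a @^-1` A) = wlength idfun A.
Proof.
move=> [[b c] _ <-] /=.
have -> : shift a @^-1` `]b, c] = `]b - a, c - a]%classic.
  by apply/seteqP; split=> x /=; rewrite !in_itv/= ltrBlDr lerBrDr.
split; first exact: is_ocitv.
rewrite !wlength_itv /= !lte_fin ltrD2r; case: ifP => // _.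
by rewrite -!EFinD; congr EFin; ring.
Qed.

(** Every cover of [A] by half-open intervals translates to one of the
    preimage, with the same total length; the reverse inequality is this one
    for [- a]. *)
Lemma outer_preimage_shift_le (R : realType) (a : R) (A : set R) :
  (leb_outer R (shift a @^-1` A) <= leb_outer R A)%E.
Proof.
apply: le_ereal_inf_tmp => _ [F [mF AF] <-].
apply: ereal_inf_lbound; exists (fun k => shift a @^-1` F k).
  split=> [k|]; first exact: (wlength_preimage_shift R a (F k) (mF k)).1.
  by rewrite -preimage_bigcup; exact: preimage_subset.
by apply: eq_eseriesr => k _; exact: (wlength_preimage_shift R a (F k) (mF k)).2.
Qed.

Lemma preimage_shiftK (R : realType) (a : R) (A : set R) :
  shift a @^-1` (shift (- a) @^-1` A) = A.
Proof. by apply/seteqP; split=> x; rewrite /preimage /= addrK. Qed.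

Lemma outer_preimage_shift (R : realType) (a : R) (A : set R) :
  leb_outer R (shift a @^-1` A) = leb_outer R A.
Proof.
apply/eqP; rewrite eq_le outer_preimage_shift_le/=.
have := outer_preimage_shift_le R (- a) (shift a @^-1` A).
by have := preimage_shiftK R (- a) A; rewrite opprK => ->.
Qed.

(** Any test set is itself a preimage under the translation, so the splitting
    condition for the preimage of [A] is the one for [A]. *)
Lemma caratheodory_preimage_shift (R : realType) (a : R) (A : set R) :
  caratheodory_measurable (leb_outer R) A ->
  caratheodory_measurable (leb_outer R) (shift a @^-1` A).
Proof.
move=> mA X.
rewrite -(preimage_shiftK R a X); move: (shift (- a) @^-1` X) => Y.
rewrite preimage_setC -!(preimage_setI (shift a)).
by rewrite !outer_preimage_shift; exact: mA.
Qed.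

Lemma measurable_shift (R : realType) (a : R) :
  measurable_fun [set: leb_line R] (shift a : leb_line R -> leb_line R).
Proof.
by move=> _ A mA; rewrite setTI; exact: caratheodory_preimage_shift.
Qed.

(** The invariance of the outer measure concerns all sets, so the measure and
    its image under the translation are equal as set functions. *)
Lemma ge0_integral_shift (R : realType) (a : R) (h : leb_line R -> \bar R) :
  measurable_fun [set: leb_line R] h -> (forall x, (0 <= h x)%E) ->
  (\int[leb_mu R]_x h (x + a)%R = \int[leb_mu R]_x h x)%E.
Proof.
move=> mh h0.
have := @ge0_integral_pushforward _ _ _ _ _ _ (measurable_shift R a)
  (leb_mu R) setT h measurableT mh (fun x _ => h0 x).
rewrite preimage_setT => <-; congr (integral _ setT h).
by apply/funext => A; exact: (outer_preimage_shift R a A).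
Qed.

Lemma normc_sqrE (R : realType) (z : R[i]) :
  Normc.normc z ^+ 2 = complex.Re z ^+ 2 + complex.Im z ^+ 2.
Proof. by case: z => x y /=; rewrite sqr_sqrtr// addr_ge0 ?sqr_ge0. Qed.

Lemma measurable_sqr_normc (R : realType) (f : R -> R[i]) :
  lebesgue_measurable_fun f ->
  measurable_fun [set: leb_line R] (fun x => Normc.normc (f x) ^+ 2).
Proof.
move=> [mre mim]; under eq_fun do rewrite normc_sqrE.
by apply: measurable_funD; exact: measurable_funX.
Qed.

(** Exchanges the norm for an integral of a nonnegative function, which can be
    compared, added and translated directly. *)
Lemma L2P (R : realType) (f : R -> R[i]) :
  L2 f <-> lebesgue_measurable_fun f /\
    (\int[leb_mu R]_x (Normc.normc (f x) ^+ 2)%:E < +oo)%E.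
Proof.
pose F (x : leb_line R) : R := Normc.normc (f x).
have -> : (\int[leb_mu R]_x (Normc.normc (f x) ^+ 2)%:E
    = Lnorm (leb_mu R) 2%:E (EFin \o F) `^ 2)%E.
  rewrite (@poweR_Lnorm _ _ _ (leb_mu R) (EFin \o F) 2)//.
  apply: eq_integral => x _.
  by rewrite /= powR_mulrn ?normr_ge0// real_normK// num_real.
suff finE : (Lnorm (leb_mu R) 2%:E (EFin \o F) `^ 2 < +oo)%E =
    (Lnorm (leb_mu R) 2%:E (EFin \o F) < +oo)%E.
  by rewrite finE.
have := Lnorm_ge0 (leb_mu R) 2%:E (EFin \o F).
by case: Lnorm => [r _|_|//]; rewrite ?poweRyr// poweR_EFin !ltry.
Qed.

Lemma L2_shift (R : realType) (a : R) (f : R -> R[i]) :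
  L2 f -> L2 (fun x => f (x + a)).
Proof.
move=> /L2P[mf fin]; apply/L2P; split.
  by case: mf => mre mim; split;
    [exact: (measurableT_comp mre (measurable_shift R a))
    |exact: (measurableT_comp mim (measurable_shift R a))].
have /= -> // := ge0_integral_shift R a (fun x => (Normc.normc (f x) ^+ 2)%:E).
  exact/measurable_EFinP/measurable_sqr_normc.
by move=> x; rewrite lee_fin sqr_ge0.
Qed.

Lemma ge0_integral_lty_le_lincomb d (T : measurableType d) (R : realType)
    (mu : {measure set T -> \bar R}) (k : R) (h g1 g2 g3 : T -> R) :
  0 <= k ->
  measurable_fun setT h -> measurable_fun setT g1 ->
  measurable_fun setT g2 -> measurable_fun setT g3 ->
  (forall x, 0 <= h x) -> (forall x, 0 <= g1 x) ->
  (forall x, 0 <= g2 x) -> (forall x, 0 <= g3 x) ->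
  (forall x, h x <= g1 x + k * (g2 x + g3 x)) ->
  (\int[mu]_x (g1 x)%:E < +oo)%E -> (\int[mu]_x (g2 x)%:E < +oo)%E ->
  (\int[mu]_x (g3 x)%:E < +oo)%E ->
  (\int[mu]_x (h x)%:E < +oo)%E.
Proof.
move=> k0 mh m1 m2 m3 h0 g10 g20 g30 le_h fin1 fin2 fin3.
have /measurable_EFinP m23 : measurable_fun setT (fun x => g2 x + g3 x).
  exact: measurable_funD.
have /measurable_EFinP mk : measurable_fun setT (fun x => k * (g2 x + g3 x)).
  by apply: measurable_funM => //; exact/measurable_EFinP.
apply: (@le_lt_trans _ _ (\int[mu]_x ((g1 x)%:E + (k * (g2 x + g3 x))%:E))%E).
  apply: ge0_le_integral => //.
  - by move=> x _; rewrite lee_fin.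
  - exact/measurable_EFinP.
  - by apply: emeasurable_funD => //; exact/measurable_EFinP.
  - by move=> x _; rewrite -EFinD lee_fin.
rewrite ge0_integralD//; last 3 first.
- by move=> x _; rewrite lee_fin.
- exact/measurable_EFinP.
- by move=> x _; rewrite lee_fin mulr_ge0// addr_ge0.
under [X in (_ + X)%E]eq_integral do rewrite EFinM.
rewrite ge0_integralZl//; last by move=> x _; rewrite lee_fin addr_ge0.
under [X in (_ + _ * X)%E]eq_integral do rewrite EFinD.
rewrite ge0_integralD//; last 4 first.
- by move=> x _; rewrite lee_fin.
- exact/measurable_EFinP.
- by move=> x _; rewrite lee_fin.
- exact/measurable_EFinP.
by rewrite lte_add_pinfty// lte_mul_pinfty// lte_add_pinfty.
Qed.

(** Here [u] and [v] stand for the values of f at x and x + pi/2, and [s], [c]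
    for sin x and cos x: the term |u|^2 c^2 of |u|^2 is bounded through
    u c = v c - (v - u) c and |p - q|^2 <= 2 (|p|^2 + |q|^2). *)
Lemma normc_rotation_bound (R : realType) (u v : R[i]) (s c : R) :
  c ^+ 2 + s ^+ 2 = 1 ->
  Normc.normc u ^+ 2 <= Normc.normc (u * s%:C) ^+ 2 +
    2 * (Normc.normc (v * c%:C) ^+ 2 + Normc.normc (v - u) ^+ 2).
Proof.
move=> cs.
have real_bound (x y : R) :
    x ^+ 2 <= (x * s) ^+ 2 + 2 * ((y * c) ^+ 2 + (y - x) ^+ 2).
  have -> : x ^+ 2 = (x * s) ^+ 2 + (x * c) ^+ 2.
    by rewrite !exprMn -mulrDr addrC cs mulr1.
  rewrite lerD2l.
  have : (c * (y - x)) ^+ 2 <= (y - x) ^+ 2.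
    rewrite exprMn ler_piMl ?sqr_ge0//.
    by rewrite -cs lerDl sqr_ge0.
  (* the parallelogram identity for y c and c (y - x), whose difference is x c *)
  have := sqr_ge0 (y * c + c * (y - x)).
  have -> : (x * c) ^+ 2 =
      2 * (y * c) ^+ 2 + 2 * (c * (y - x)) ^+ 2 - (y * c + c * (y - x)) ^+ 2.
    by ring.
  lra.
move: u v => [ux uy] [vx vy]; rewrite !normc_sqrE /= !mulr0 !subr0 !add0r.
by apply: (le_trans (lerD (real_bound ux vx) (real_bound uy vy))); lra.
Qed.

Theorem claim2 (R : realType) (f : R -> R[i])
    (mf : lebesgue_measurable_fun f)
    (Delta_L2 : L2 (fun x : R => f (x + pi / 2) - f x))
    (fsin_L2 : L2 (fun x : R => f x * (sin x)%:C)) :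
  L2 f.
Proof.
have /L2P[mG finG] := L2_shift R (pi / 2) _ fsin_L2.
have /L2P[mg fing] := fsin_L2.
have /L2P[mD finD] := Delta_L2.
apply/L2P; split=> //.
have normc_sq_ge0 (z : R[i]) : 0 <= Normc.normc z ^+ 2 by exact: sqr_ge0.
apply: (ge0_integral_lty_le_lincomb _ _ _ (leb_mu R) 2 _ _ _ _ (ler0n R 2)
  (measurable_sqr_normc _ _ mf) (measurable_sqr_normc _ _ mg)
  (measurable_sqr_normc _ _ mG) (measurable_sqr_normc _ _ mD)) => // x.
rewrite sinDpihalf; exact/normc_rotation_bound/cos2Dsin2.
Qed.
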